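(* Let $\mu_1>0$ and let the parameters $\tau>1$ and $\mu_0>0$ be chosen such that $1-\frac1\tau-\frac{\mu_0}{4\nu}>0$. Then the noisy-data RIGKT algorithm (described in the context) terminates in finitely many steps; that is, for every realization of the random indices $\{i_{k,m}\}$ the stopping index satisfies $k_\delta<\infty$.
   Context: A discretization level is fixed and suppressed in the notation. The finite-dimensional solution space is identified with $\mathbb R^{n_2}$ with the Euclidean inner product $\langle\cdot,\cdot\rangle$ and norm; $^*$ denotes transpose. Functional: $\mathfrak f:\mathbb R^{n_2}\to\mathbb R\cup\{+\infty\}$ is proper, lower semicontinuous and $\nu$-strongly convex with $\nu>0$, i.e. $\mathfrak f(\lambda u+(1-\lambda)\bar u)+\nu\lambda(1-\lambda)\|u-\bar u\|^2\le\lambda \mathfrak f(u)+(1-\lambda)\mathfrak f(\bar u)$ for all $u,\bar u\in\operatorname{dom}(\mathfrak f)$, $\lambda\in[0,1]$. Write $P(\zeta):=\arg\min_u\{\mathfrak f(u)-\langle\zeta,u\rangle\}$ (unique minimizer, so $\zeta\in\partial \mathfrak f(P(\zeta))$). Projected systems: for $i=1,\dots,q$ let $\mathcal T_i\in\mathbb R^{n_1\times n_2}$, exact data $v_i\in\mathbb R^{n_1}$, and $1\le l<\min\{n_1,n_2\}$. Golub–Kahan bidiagonalization of $\mathcal T_i$ (in the paper with starting vector $v_i^\delta$) gives $\mathcal T_iV_i=U_iB_i$ and $\mathcal T_i^*U_i'=V_i(B_i')^*$, where $V_i\in\mathbb R^{n_2\times l}$ and $U_i\in\mathbb R^{n_1\times(l+1)}$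 have orthonormal columns, $B_i\in\mathbb R^{(l+1)\times l}$ is lower bidiagonal of rank $l$, $U_i'$ consists of the first $l$ columns of $U_i$ and $B_i'$ of the first $l$ rows of $B_i$. Put $\mathcal T_i^l:=U_iB_iV_i^*$ and assume $\mathcal S:=\{u\in\operatorname{dom}(\mathfrak f):\mathcal T_i^lu=v_i,\ i=1,\dots,q\}\neq\emptyset$. Noisy data: $v_i^\delta\in\mathbb R^{n_1}$ with $\|v_i^\delta-v_i\|\le\delta_i$, where $\delta_i>0$ for all $i$; $\delta=(\delta_1^2+\dots+\delta_q^2)^{1/2}$. Regularization parameters: $(\gamma_j)_{j\ge0}$ is a monotonically decreasing sequence of positive reals with $\sum_j1/\gamma_j=\infty$. In the algorithm, $\gamma_{k,m}:=\gamma_{\mathfrak z_{k,m}}$ and (for outer updates) $\gamma_k:=\gamma_{\mathfrak z_k}$, where $\mathfrak z_{k,m}$, $\mathfrak z_k$ are the total numbers of (inner and outer) updates performed up to the inner step $(k,m)$, respectively the outer step $k$: $\mathfrak z_{k,m}=\sum_{j<k}m_j+k+m$ and $\mathfrak z_k=\sum_{j<k}m_j+k-1$ for $k\ge1$. Below, a symbol $\gamma_k$ attached to an outer step is understood in this sense. Noisy-data RIGKT algorithm. Input: $\tau>1,\mu_0>0,\mu_1>0$, $\zeta_0\in\mathbb R^{n_2}$, positive integers $m_0,m_1,\dots$. Set $\zeta_{0,0}^\delta=\zeta_0^\delta=\zeta_0$, $u_{0,0}^\delta=u_0^\delta=P(\zeta_0)$. For $k=0,1,2,\dots$: (inner loop)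 for $m=0,\dots,m_k-1$: draw $i=i_{k,m}\in\{1,\dots,q\}$ uniformly at random (independently); with $A=\gamma_{k,m}I+B_iB_i^*$ set $h_{k,m}^\delta=A^{-1/2}U_i^*(\mathcal T_i^lu_{k,m}^\delta-v_i^\delta)$, $g_{k,m}^\delta=V_iB_i^*A^{-1/2}h_{k,m}^\delta$; $t_{k,m}^\delta=\min\{\mu_0\|h_{k,m}^\delta\|^2/\|g_{k,m}^\delta\|^2,\mu_1\}$ if $\gamma_{k,m}\|h_{k,m}^\delta\|^2>\tau^2\delta_i^2$ and $t_{k,m}^\delta=0$ otherwise; $\zeta_{k,m+1}^\delta=\zeta_{k,m}^\delta-t_{k,m}^\delta g_{k,m}^\delta$, $u_{k,m+1}^\delta=P(\zeta_{k,m+1}^\delta)$. (outer step) $\zeta_{k+1}^\delta=\zeta_{k,m_k}^\delta$, $u_{k+1}^\delta=u_{k,m_k}^\delta$. With $K=k+1$, $A_{K,i}=\gamma_KI+B_iB_i^*$, $h_{K,i}^\delta=A_{K,i}^{-1/2}U_i^*(\mathcal T_i^lu_K^\delta-v_i^\delta)$: if $\gamma_K\|h_{K,i}^\delta\|^2\le\tau^2\delta_i^2$ for all $i$, the algorithm stops with output $u_K^\delta$. Otherwise put $\Delta_K^\delta=\{i:\gamma_K\|h_{K,i}^\delta\|^2>\tau^2\delta_i^2\}$, $g_K^\delta=\sum_{i\in\Delta_K^\delta}V_iB_i^*A_{K,i}^{-1/2}h_{K,i}^\delta$, $\Phi_K^\delta=\sum_{i\in\Delta_K^\delta}\|h_{K,i}^\delta\|^2$;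 $t_K^\delta=\min\{\mu_0\Phi_K^\delta/\|g_K^\delta\|^2,\mu_1\}$; $\zeta_{K,0}^\delta=\zeta_K^\delta-t_K^\delta g_K^\delta$, $u_{K,0}^\delta=P(\zeta_{K,0}^\delta)$, and continue with the next $k$. A quotient with $g=0$ in the denominator is read as $+\infty$ (step size $\mu_1$). The stopping index $k_\delta$ is the smallest $k\ge1$ with $\gamma_k\|h_{k,i}^\delta\|^2\le\tau^2\delta_i^2$ for all $i$ ($k_\delta=\infty$ if there is none). *)

(* Defs.v *)
From HB Require Import structures.
From mathcomp Require Import all_boot all_order all_algebra.
From mathcomp Require Import all_classical all_reals all_analysis.

Set Implicit Arguments.
Unset Strict Implicit.
Unset Printing Implicit Defensive.

Import Order.TTheory GRing.Theory Num.Theory.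
Import numFieldNormedType.Exports.

Local Open Scope classical_set_scope.
Local Open Scope ring_scope.

(* The library norm on matrices is the sup norm, hence the Euclidean one here. *)
Definition dotv (R : realType) (n : nat) (x y : 'cV[R]_n) : R :=
  \sum_(i < n) x i 0 * y i 0.

Definition enorm (R : realType) (n : nat) (x : 'cV[R]_n) : R :=
  Num.sqrt (dotv x x).

Definition psdmx (R : realType) (n : nat) (S : 'M[R]_n) : Prop :=
  S^T = S /\ forall x : 'cV[R]_n, 0 <= dotv x (S *m x).

(* [xget 0] only supplies a junk value when [A] is not symmetric positive
   semidefinite; otherwise the square root exists and is unique. *)
Definition sqrtmx (R : realType) (n : nat) (A : 'M[R]_n) : 'M[R]_n :=
  xget 0 [set S | psdmx S /\ S *m S = A].

Definition invsqrtmx (R : realType) (n : nat) (A : 'M[R]_n) : 'M[R]_n :=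
  sqrtmx (invmx A).

Definition edom (R : realType) (n : nat) (f : 'cV[R]_n -> \bar R) :
    set 'cV[R]_n :=
  [set u | (f u < +oo)%E].

Definition proper_fun (R : realType) (n : nat) (f : 'cV[R]_n -> \bar R) : Prop :=
  (forall u, f u <> -oo%E) /\ edom f !=set0.

Definition strongly_convex (R : realType) (n : nat) (nu : R)
    (f : 'cV[R]_n -> \bar R) : Prop :=
  forall (u w : 'cV[R]_n) (lam : R),
    edom f u -> edom f w -> 0 <= lam <= 1 ->
    (f (lam *: u + (1 - lam) *: w)%R
       + (nu * lam * (1 - lam) * enorm (u - w) ^+ 2)%R%:E
     <= lam%:E * f u + (1 - lam)%R%:E * f w)%E.

(* The minimizer exists and is unique when [f] is proper, lower semicontinuous
   and strongly convex, so the default 0 is then never used. *)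
Definition argmin_tilt (R : realType) (n : nat) (f : 'cV[R]_n -> \bar R)
    (zeta : 'cV[R]_n) : 'cV[R]_n :=
  xget 0 [set u | forall w,
    (f u - (dotv zeta u)%:E <= f w - (dotv zeta w)%:E)%E].

Definition lower_bidiagonal (R : realType) (p l : nat) (B : 'M[R]_(p, l)) : Prop :=
  forall (a : 'I_p) (b : 'I_l), a != b :> nat -> a != b.+1 :> nat -> B a b = 0.

(* [lsubmx U] consists of the first l columns of U, and [usubmx B] of the
   first l rows of B. *)
Definition golub_kahan (R : realType) (n1 n2 l : nat) (T : 'M[R]_(n1, n2))
    (V : 'M[R]_(n2, l)) (U : 'M[R]_(n1, l + 1)) (B : 'M[R]_(l + 1, l)) : Prop :=
  [/\ T *m V = U *m B /\ T^T *m lsubmx U = V *m (usubmx B)^T,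
      V^T *m V = 1%:M,
      U^T *m U = 1%:M,
      lower_bidiagonal B &
      \rank B = l].

Definition projected_mx (R : realType) (n1 n2 l : nat) (V : 'M[R]_(n2, l))
    (U : 'M[R]_(n1, l + 1)) (B : 'M[R]_(l + 1, l)) : 'M[R]_(n1, n2) :=
  U *m B *m V^T.

Definition solution_set (R : realType) (n1 n2 l q : nat)
    (f : 'cV[R]_n2 -> \bar R) (V : 'I_q -> 'M[R]_(n2, l))
    (U : 'I_q -> 'M[R]_(n1, l + 1)) (B : 'I_q -> 'M[R]_(l + 1, l))
    (v : 'I_q -> 'cV[R]_n1) : set 'cV[R]_n2 :=
  [set u | edom f u /\ forall i, projected_mx (V i) (U i) (B i) *m u = v i].

(* The noisy-data algorithm.  The iterates [u] are always [argmin_tilt f] of the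
   dual iterates [zeta], so only the latter are carried along.  [idx k m] is a
   realization of the random index drawn at inner step (k, m).  The recursion is
   total: it is not interrupted when the stopping test succeeds, so it describes
   the algorithm up to the first index passing the test, i.e. [stopping_index]. *)
Section RIGKT.
Variables (R : realType) (n1 n2 l q : nat).
Variable f : 'cV[R]_n2 -> \bar R.
Variables (V : 'I_q -> 'M[R]_(n2, l)) (U : 'I_q -> 'M[R]_(n1, l + 1)).
Variable B : 'I_q -> 'M[R]_(l + 1, l).
Variables (vd : 'I_q -> 'cV[R]_n1) (delta : 'I_q -> R).
Variables (gamma : nat -> R) (tau mu0 mu1 : R).
Variables (zeta0 : 'cV[R]_n2) (mm : nat -> nat) (idx : nat -> nat -> 'I_q).

Definition precond (gam : R) (i : 'I_q) : 'M[R]_(l + 1) :=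
  invsqrtmx (gam%:M + B i *m (B i)^T).

Definition hvec (gam : R) (i : 'I_q) (u : 'cV[R]_n2) : 'cV[R]_(l + 1) :=
  precond gam i *m (U i)^T *m (projected_mx (V i) (U i) (B i) *m u - vd i).

Definition gvec (gam : R) (i : 'I_q) (u : 'cV[R]_n2) : 'cV[R]_n2 :=
  V i *m (B i)^T *m precond gam i *m hvec gam i u.

Definition active (gam : R) (i : 'I_q) (u : 'cV[R]_n2) : bool :=
  tau ^+ 2 * delta i ^+ 2 < gam * enorm (hvec gam i u) ^+ 2.

(* A quotient by zero counts as +oo, so the minimum is then [mu1]. *)
Definition step_size (Phi : R) (g : 'cV[R]_n2) : R :=
  if g == 0 then mu1 else Num.min (mu0 * Phi / enorm g ^+ 2) mu1.

Definition inner_step (gam : R) (i : 'I_q) (zeta : 'cV[R]_n2) : 'cV[R]_n2 :=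
  let u := argmin_tilt f zeta in
  let h := hvec gam i u in
  let g := gvec gam i u in
  let t := if active gam i u then step_size (enorm h ^+ 2) g else 0 in
  zeta - t *: g.

Definition outer_step (gam : R) (zeta : 'cV[R]_n2) : 'cV[R]_n2 :=
  let u := argmin_tilt f zeta in
  let g := \sum_(i < q | active gam i u) gvec gam i u in
  let Phi := \sum_(i < q | active gam i u) enorm (hvec gam i u) ^+ 2 in
  zeta - step_size Phi g *: g.

Definition inner_count (k m : nat) : nat := (\sum_(j < k) mm j + k + m)%N.

(* Only used for k >= 1, where the subtraction is not truncated. *)
Definition outer_count (k : nat) : nat := (\sum_(j < k) mm j + k - 1)%N.

Fixpoint inner_loop (k : nat) (zeta : 'cV[R]_n2) (m : nat) : 'cV[R]_n2 :=
  if m is m'.+1 then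
    inner_step (gamma (inner_count k m')) (idx k m') (inner_loop k zeta m')
  else zeta.

(* [zeta_start k] is zeta_{k,0}; [zeta_outer k] is zeta_k. *)
Fixpoint zeta_start (k : nat) : 'cV[R]_n2 :=
  if k is k'.+1 then
    outer_step (gamma (outer_count k)) (inner_loop k' (zeta_start k') (mm k'))
  else zeta0.

Definition zeta_outer (k : nat) : 'cV[R]_n2 :=
  if k is k'.+1 then inner_loop k' (zeta_start k') (mm k') else zeta0.

Definition u_outer (k : nat) : 'cV[R]_n2 := argmin_tilt f (zeta_outer k).

Definition stop_test (k : nat) : Prop :=
  forall i : 'I_q,
    gamma (outer_count k) * enorm (hvec (gamma (outer_count k)) i (u_outer k)) ^+ 2
      <= tau ^+ 2 * delta i ^+ 2.

Definition stopping_index (kd : nat) : Prop :=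
  [/\ (1 <= kd)%N, stop_test kd &
      forall k, (1 <= k < kd)%N -> ~ stop_test k].

End RIGKT.

(* Main.v *)
(* Fix a solution [usol] of the projected systems and follow the Bregman distance
   f(usol) - f(u) - <zeta, usol - u> with u = P(zeta), which is nonnegative.
   Strong convexity makes the convex conjugate of f smooth, so a step of size t
   along a direction g lowers the distance by at least
   t <g, u - usol> - t^2 |g|^2 / (4 nu).  For an active index the residual
   dominates the noise, so <g_i, u - usol> >= (1 - 1/tau) |h_i|^2, and the choice
   of step size gives t |g|^2 <= mu0 Phi; hence the decrease is at least
   (1 - 1/tau - mu0/(4 nu)) t Phi >= 0.  If the test fails at an outer step, then
   t is bounded below (as |g|^2 <= q^2 Phi) and Phi > tau^2 delta_i^2 / gamma_0 for
   some i, so every failure costs a fixed positive amount. *)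

Require Import Defs.
From HB Require Import structures.
From mathcomp Require Import all_boot all_order all_algebra.
From mathcomp Require Import all_classical all_reals all_analysis.
From mathcomp Require Import complex.
From mathcomp Require Import ring lra.

Set Implicit Arguments.
Unset Strict Implicit.
Unset Printing Implicit Defensive.

Import Order.TTheory GRing.Theory Num.Theory.
Import numFieldNormedType.Exports.

Local Open Scope classical_set_scope.
Local Open Scope ring_scope.

(** * Euclidean inner product and norm on column vectors *)

Section Euclidean.
Context {R : realType}.

Lemma dotvE n (x y : 'cV[R]_n) : dotv x y = (x^T *m y) 0 0.
Proof. by rewrite mxE; apply: eq_bigr => i _; rewrite mxE. Qed.

Lemma dotvC n (x y : 'cV[R]_n) : dotv x y = dotv y x.
Proof. by apply: eq_bigr => i _; rewrite mulrC. Qed.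

Lemma dotvDr n (x y z : 'cV[R]_n) : dotv x (y + z) = dotv x y + dotv x z.
Proof. by rewrite !dotvE mulmxDr mxE. Qed.

Lemma dotvZr n a (x y : 'cV[R]_n) : dotv x (a *: y) = a * dotv x y.
Proof. by rewrite !dotvE -scalemxAr mxE. Qed.

Lemma dotvNr n (x y : 'cV[R]_n) : dotv x (- y) = - dotv x y.
Proof. by rewrite -scaleN1r dotvZr mulN1r. Qed.

Lemma dotvBr n (x y z : 'cV[R]_n) : dotv x (y - z) = dotv x y - dotv x z.
Proof. by rewrite dotvDr dotvNr. Qed.

Lemma dotvDl n (x y z : 'cV[R]_n) : dotv (x + y) z = dotv x z + dotv y z.
Proof. by rewrite !(dotvC _ z) dotvDr. Qed.

Lemma dotvZl n a (x y : 'cV[R]_n) : dotv (a *: x) y = a * dotv x y.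
Proof. by rewrite !(dotvC _ y) dotvZr. Qed.

Lemma dotvBl n (x y z : 'cV[R]_n) : dotv (x - y) z = dotv x z - dotv y z.
Proof. by rewrite !(dotvC _ z) dotvBr. Qed.

Lemma dotv_suml n I (r : seq I) (P : pred I) (F : I -> 'cV[R]_n) y :
  dotv (\sum_(i <- r | P i) F i) y = \sum_(i <- r | P i) dotv (F i) y.
Proof.
by rewrite dotvC dotvE mulmx_sumr summxE; apply: eq_bigr => i _; rewrite dotvC dotvE.
Qed.

Lemma dotv_mull m n (A : 'M[R]_(m, n)) x y : dotv (A *m x) y = dotv x (A^T *m y).
Proof. by rewrite !dotvE trmx_mul mulmxA. Qed.

Lemma dotv_ge0 n (x : 'cV[R]_n) : 0 <= dotv x x.
Proof. by apply: sumr_ge0 => i _; rewrite -expr2 sqr_ge0. Qed.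

Lemma enorm_ge0 n (x : 'cV[R]_n) : 0 <= enorm x.
Proof. exact: sqrtr_ge0. Qed.

Lemma sqr_enorm n (x : 'cV[R]_n) : enorm x ^+ 2 = dotv x x.
Proof. by rewrite sqr_sqrtr // dotv_ge0. Qed.

Lemma enorm_eq0 n (x : 'cV[R]_n) : (enorm x == 0) = (x == 0).
Proof.
apply/eqP/eqP => [x0|->]; last first.
  by rewrite /enorm /dotv big1 ?sqrtr0 // => i _; rewrite mxE mul0r.
have /eqP : dotv x x = 0 by rewrite -sqr_enorm x0 expr0n.
rewrite psumr_eq0 => [/allP h|i _]; last by rewrite -expr2 sqr_ge0.
apply/colP => i; rewrite mxE; apply/eqP.
by have := h i (mem_index_enum i); rewrite -expr2 sqrf_eq0.
Qed.

Lemma enormN n (x : 'cV[R]_n) : enorm (- x) = enorm x.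
Proof. by rewrite /enorm dotvNr dotvC dotvNr opprK. Qed.

Lemma enormZ n a (x : 'cV[R]_n) : enorm (a *: x) = `|a| * enorm x.
Proof.
by rewrite /enorm dotvZl dotvZr mulrA -expr2 sqrtrM ?sqr_ge0 // sqrtr_sqr.
Qed.

Lemma dotv_le n (x y : 'cV[R]_n) : dotv x y <= enorm x * enorm y.
Proof.
have [|] := eqVneq (enorm x * enorm y) 0.
  move=> /[dup] xy0 /eqP; rewrite mulf_eq0 !enorm_eq0 xy0.
  by case/orP => /eqP ->; rewrite /dotv big1 // => i _; rewrite mxE ?mul0r ?mulr0.
have := dotv_ge0 (enorm y *: x - enorm x *: y).
rewrite !(dotvBl, dotvBr, dotvZl, dotvZr) -!sqr_enorm (dotvC y x) => h.
have xy_ge0 := mulr_ge0 (enorm_ge0 x) (enorm_ge0 y).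
rewrite eq_sym => xy_neq0.
have xy_gt0 : 0 < enorm x * enorm y by rewrite lt_def eq_sym xy_neq0.
by rewrite -(ler_pM2l xy_gt0); lra.
Qed.

Lemma enormD n (x y : 'cV[R]_n) : enorm (x + y) <= enorm x + enorm y.
Proof.
rewrite -(ler_pXn2r (n := 2)) ?nnegrE ?addr_ge0 ?enorm_ge0 //.
rewrite sqr_enorm sqrrD dotvDl !dotvDr (dotvC y x) -!sqr_enorm.
by have := dotv_le x y; lra.
Qed.

Lemma enorm_sum n I (r : seq I) (P : pred I) (F : I -> 'cV[R]_n) :
  enorm (\sum_(i <- r | P i) F i) <= \sum_(i <- r | P i) enorm (F i).
Proof.
elim/big_rec2 : _ => [|i y x _ h].
  by rewrite (eqP (_ : enorm 0 == 0)) ?enorm_eq0.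
by apply: le_trans (enormD _ _) _; rewrite lerD2l.
Qed.

(** Completing the square: [x - (2 * nu) *: y] has nonnegative squared length. The weights are
    chosen so that the first term cancels against the growth term of a [nu]-strongly convex
    function. *)
Lemma dotv_young n (nu : R) (x y : 'cV[R]_n) : 0 < nu ->
  dotv x y <= nu * enorm y ^+ 2 + enorm x ^+ 2 / (4 * nu).
Proof.
move=> nu0; have nu4 : 0 < 4 * nu by rewrite mulr_gt0.
have := dotv_ge0 (x - (2 * nu) *: y).
rewrite !(dotvBl, dotvBr, dotvZl, dotvZr) -!sqr_enorm (dotvC y x) => h.
by rewrite -(ler_pM2l nu4) mulrDr (mulrC (4 * nu) (_ / _)) divfK ?gt_eqF //; lra.
Qed.

Lemma enorm_isometry m n (V : 'M[R]_(m, n)) x :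
  V^T *m V = 1%:M -> enorm (V *m x) = enorm x.
Proof. by move=> VV; rewrite /enorm dotv_mull mulmxA VV mul1mx. Qed.

(* [U U^T] is the orthogonal projection onto the column space of [U]. *)
Lemma enorm_coisometry_le m n (U : 'M[R]_(m, n)) x :
  U^T *m U = 1%:M -> enorm (U^T *m x) <= enorm x.
Proof.
move=> UU; rewrite -(ler_pXn2r (n := 2)) ?nnegrE ?enorm_ge0 // !sqr_enorm.
have := dotv_ge0 (x - U *m (U^T *m x)).
rewrite !(dotvBl, dotvBr) (dotvC x (U *m _)) !(dotv_mull U).
by rewrite (mulmxA U^T U) UU mul1mx; lra.
Qed.

(** Balls and limits of vectors are taken in the sup norm; this bound and the next one carry
    estimates between that topology and the Euclidean pairing. *)
Lemma normr_le_enorm n (x : 'cV[R]_n) : `|x| <= enorm x.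
Proof.
rewrite [leLHS]/Num.norm /= mx_normrE; apply/bigmax_leP; split=> [|[i j] _ /=].
  exact: enorm_ge0.
rewrite (ord1 j) -(ler_pXn2r (n := 2)) ?nnegrE ?enorm_ge0 // sqr_enorm.
rewrite real_normK ?num_real // /dotv (bigD1 i) //= -expr2 lerDl.
by apply: sumr_ge0 => k _; rewrite -expr2 sqr_ge0.
Qed.

Lemma normr_dotv_le n (x y : 'cV[R]_n) :
  `|dotv x y| <= (\sum_(i < n) `|x i 0|) * `|y|.
Proof.
apply: le_trans (ler_norm_sum _ _ _) _; rewrite mulr_suml; apply: ler_sum => i _.
rewrite normrM ler_wpM2l // [leRHS]/Num.norm /= mx_normrE.
by apply/bigmax_geP; right; exists (i, 0).
Qed.

End Euclidean.

(** * Square roots of positive semidefinite matrices, obtained as polynomials in the matrix *)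

Lemma poly_interpolation (F : fieldType) (s : seq F) (g : F -> F) :
  exists p : {poly F}, forall x, x \in s -> p.[x] = g x.
Proof.
elim: s => [|a s [p ph]]; first by exists 0.
(* Since [w] vanishes exactly on [s], adding a multiple of it corrects the value at a new node [a]
   without disturbing the earlier ones. *)
pose w := \prod_(b <- s) ('X - b%:P).
have [aas|aNs] := boolP (a \in s).
  by exists p => x; rewrite inE => /predU1P[->|/ph//]; exact: ph.
have wa : w.[a] != 0 by rewrite -[_ == _]/(root w a) root_prod_XsubC.
exists (p + ((g a - p.[a]) / w.[a]) *: w) => x.
rewrite !hornerE inE => /predU1P[->|xs]; first by rewrite divfK // addrC subrK.
have /eqP -> : w.[x] == 0 by rewrite -[_ == _]/(root w x) root_prod_XsubC.
by rewrite mulr0 addr0 ph.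
Qed.

Lemma trmx_horner_mx (R : comNzRingType) n (A : 'M[R]_n.+1) (p : {poly R}) :
  (horner_mx A p)^T = horner_mx A^T p.
Proof.
elim/poly_ind: p => [|p c ih]; first by rewrite !rmorph0 trmx0.
rewrite !(rmorphD, rmorphM) /= !horner_mx_X !horner_mx_C raddfD /= tr_scalar_mx.
rewrite [(_ * _)^T]trmx_mul ih; congr (_ + _).
by have := comm_horner_mx2 A^T 'X p; rewrite horner_mx_X.
Qed.

Section SquareRoot.
Context {R : realType}.
Local Notation toC := (real_complex R).

Lemma psdmx_eigenvalue_ge0 n (A : 'M[R]_n) a :
  psdmx A -> eigenvalue A a -> 0 <= a.
Proof.
move=> [AT A_ge0] /eigenvalueP[v vA v0].
have : 0 <= dotv v^T (A *m v^T) by [].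
have -> : A *m v^T = a *: v^T by rewrite -{1}AT -trmx_mul vA linearZ.
rewrite dotvZr pmulr_lge0 // lt_def dotv_ge0 andbT -sqr_enorm sqrf_eq0 enorm_eq0.
by rewrite -(inj_eq trmx_inj) trmxK trmx0.
Qed.

(** The complexified matrix is Hermitian, so the spectral theorem gives a real diagonal.
    Characteristic polynomials commute with the embedding of the reals, so each diagonal entry is
    already an eigenvalue of [A] itself and is nonnegative. *)
Lemma psdmx_complex_diag n (A : 'M[R]_n.+1) : psdmx A ->
  exists P (d : 'I_n.+1 -> R), [/\ P \in unitmx,
    map_mx toC A = invmx P *m diag_mx (\row_i toC (d i)) *m P &
    forall i, 0 <= d i].
Proof.
move=> Apsd; pose AC := map_mx toC A.
have ACherm : AC \is hermsymmx.
  apply/is_hermitianmxP; rewrite expr0 scale1r.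
  apply/matrixP => i j; rewrite !mxE -{1}Apsd.1 mxE.
  by apply/eqP; rewrite eq_complex /= oppr0 !eqxx.
have [P [D [PU ACE Dreal]]] : exists P D,
    [/\ P \in unitmx, AC = invmx P *m diag_mx D *m P & D \is a realmx].
  exists (spectralmx AC), (spectral_diag AC).
  split; [exact: spectral_unit | | exact: hermitian_spectral_diag_real].
  exact/orthomx_spectralP/hermitian_normalmx.
have DE i : D 0 i = toC (complex.Re (D 0 i)).
  by rewrite RRe_real //; move/mxOverP : Dreal; apply.
have DrowE : D = \row_i toC (complex.Re (D 0 i)).
  by apply/rowP => i; rewrite mxE -DE.
exists P, (fun i => complex.Re (D 0 i)); split; [exact: PU | by rewrite -DrowE |].
move=> i; apply: (psdmx_eigenvalue_ge0 Apsd).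
suff : eigenvalue AC (toC (complex.Re (D 0 i))).
  by rewrite !eigenvalue_root_char -map_char_poly fmorph_root.
rewrite -DE; apply/eigenvalueP; exists (row i P).
  rewrite -/AC ACE !mulmxA -row_mul mulmxV // row1 -rowE row_diag_mx.
  by rewrite -scalemxAl -rowE.
(* A zero row of [P] would force a zero on the diagonal of [P *m invmx P], which is the identity. *)
apply/eqP => Pi0; have /eqP := oner_neq0 R[i].
by have := row_mul i P (invmx P); rewrite Pi0 mul0mx mulmxV // row1 => /rowP /(_ i);
   rewrite !mxE !eqxx.
Qed.

(* With [p] interpolating the fourth root on the spectrum, [p(A)] is symmetric
   and [p(A)^2] is the square root of [A]. *)
Lemma psdmx_sqrt_exists n (A : 'M[R]_n) : psdmx A ->
  exists S, psdmx S /\ S *m S = A.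
Proof.
case: n A => [|n] A Apsd.
  exists 0; split; last by apply/matrixP => -[].
  by split=> [|x]; rewrite ?trmx0 // mul0mx dotvE mulmx0 mxE.
have [P [d [PU AE d_ge0]]] := psdmx_complex_diag Apsd.
have [p pd] := poly_interpolation [seq d i | i <- enum 'I_n.+1]
  (fun x => Num.sqrt (Num.sqrt x)).
have pdE i : p.[d i] ^+ 4 = d i.
  rewrite pd ?map_f ?mem_enum // (exprM _ 2 2) sqr_sqrtr ?sqrtr_ge0 //.
  by rewrite sqr_sqrtr.
pose S := horner_mx A p.
have ST : S^T = S by rewrite trmx_horner_mx Apsd.1.
have S4 : S ^+ 4 = A.
  (* The embedding is injective on matrices, so the identity can be checked over the complex
     numbers, where [A] is diagonal and [p ^+ 4] fixes every [d i]. *)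
  apply: (map_mx_inj (f := toC)).
  rewrite -[S ^+ 4]/((horner_mx A p) ^+ 4) -rmorphXn /= map_horner_mx AE.
  rewrite horner_mx_uconjC // horner_mx_diag.
  have -> // : map_mx (horner (map_poly toC (p ^+ 4))) (\row_i toC (d i))
             = \row_i toC (d i).
  by apply/rowP => i; rewrite !mxE horner_map /= horner_exp pdE.
exists (S *m S); split; last by rewrite -S4 !mulmxA !exprS expr0 mulr1 !mulrA.
split=> [|x]; first by rewrite trmx_mul ST.
by rewrite -mulmxA -{1}ST -dotv_mull dotv_ge0.
Qed.

Lemma sqrtmxP n (A : 'M[R]_n) : psdmx A -> psdmx (sqrtmx A) /\ sqrtmx A *m sqrtmx A = A.
Proof. by move=> /psdmx_sqrt_exists h; exact: (@xgetPex _ 0 _ h). Qed.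

End SquareRoot.

(** * Existence of the tilted minimizer and quadratic growth around it *)

Section TiltedMinimizer.
Context {R : realType} {n : nat} (f : 'cV[R]_n -> \bar R) (nu : R).
Hypotheses (f_proper : proper_fun f) (f_lsc : lower_semicontinuous f).
Hypotheses (nu_gt0 : 0 < nu) (f_sc : strongly_convex nu f).
Implicit Types (u w zeta : 'cV[R]_n).

Lemma fineK_edom u : edom f u -> (fine (f u))%:E = f u.
Proof.
rewrite /edom /= => fu; rewrite fineK // fin_numE (lt_eqF fu) andbT.
by apply/eqP/f_proper.1.
Qed.

Lemma strongly_convex_fine u w lam : edom f u -> edom f w -> 0 <= lam <= 1 ->
  edom f (lam *: u + (1 - lam) *: w) /\
  fine (f (lam *: u + (1 - lam) *: w)) + nu * lam * (1 - lam) * enorm (u - w) ^+ 2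
    <= lam * fine (f u) + (1 - lam) * fine (f w).
Proof.
move=> fu fw lam01; have := f_sc fu fw lam01; set y := _ + _ *: w.
rewrite -(fineK_edom fu) -(fineK_edom fw) -!EFinM -EFinD /= => h.
have fy : edom f y.
  move: h; rewrite /edom /=; case: (f y) => [a||] // _; exact: ltry.
by split => //; move: h; rewrite -(fineK_edom fy) -EFinD lee_fin.
Qed.

(** A real-valued objective keeps the estimates within real arithmetic. It is meaningful only on
    [edom f], because [fine] sends an infinite value to 0. *)
Definition tilted zeta u : R := fine (f u) - dotv zeta u.

Lemma strongly_convex_tilted zeta u w lam :
  edom f u -> edom f w -> 0 <= lam <= 1 ->
  tilted zeta (lam *: u + (1 - lam) *: w)
      + nu * lam * (1 - lam) * enorm (u - w) ^+ 2
    <= lam * tilted zeta u + (1 - lam) * tilted zeta w.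
Proof.
move=> fu fw lam01; have [_] := strongly_convex_fine fu fw lam01.
by rewrite /tilted dotvDr !dotvZr; lra.
Qed.

(* Lower semicontinuity bounds [f] from below near a point of its domain;
   strong convexity along rays from that point propagates this to a quadratic
   lower bound everywhere. *)
Lemma tilted_bounded_below zeta :
  exists m, forall w, edom f w -> m <= tilted zeta w.
Proof.
have [x0 fx0] := f_proper.2.
have [|A /nbhs_ballP[e /= e0 eA] Af] := f_lsc (x := x0) (a := fine (f x0) - 1).
  by rewrite -{2}(fineK_edom fx0) lte_fin; lra.
pose r := e / 2; have r0 : 0 < r by rewrite divr_gt0.
have near_x0 w : edom f w -> enorm (w - x0) <= r -> fine (f x0) - 1 < fine (f w).
  move=> fw wr; rewrite -lte_fin (fineK_edom fw); apply/Af/eA.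
  rewrite -ball_normE /= distrC; apply: le_lt_trans (normr_le_enorm _) _.
  by apply: le_lt_trans wr _; rewrite ltr_pdivrMr // ltr_pMr // ltr1n.
(* [K] adds the slope [r^-1 + nu * r] of the lower bound for [f] to the slope [enorm zeta] of the
   tilt; [- K ^+ 2 / (4 * nu)] is the least value of [nu * d ^+ 2 - K * d]. *)
pose K := r^-1 + nu * r + enorm zeta.
exists (tilted zeta x0 - 1 - K ^+ 2 / (4 * nu)) => w fw.
set d := enorm (w - x0).
have d0 : 0 <= d by exact: enorm_ge0.
have zw : dotv zeta w <= enorm zeta * d + dotv zeta x0.
  by rewrite -{1}(subrK x0 w) dotvDr lerD2r dotv_le.
have Kd : - (K ^+ 2 / (4 * nu)) <= nu * d ^+ 2 - K * d.
  have nu4 : 0 < 4 * nu by rewrite mulr_gt0.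
  rewrite -(ler_pM2l nu4) mulrN (mulrC (4 * nu) (_ / _)) divfK ?gt_eqF //.
  by have := sqr_ge0 (2 * nu * d - K); lra.
suff : fine (f x0) - 1 - (r^-1 + nu * r) * d + nu * d ^+ 2 <= fine (f w).
  by move: zw Kd; rewrite /tilted /K; lra.
have rd0 : 0 <= r^-1 * d by rewrite mulr_ge0 // invr_ge0 ltW.
have [dr|rd] := leP d r.
  have := near_x0 _ fw dr; have : nu * d * (d - r) <= 0.
    by rewrite mulr_ge0_le0 ?subr_le0 // mulr_ge0 // ltW.
  by move: rd0; lra.
have dgt0 : 0 < d by exact: lt_trans rd.
(* The point with parameter [s] on the segment from [x0] to [w] is at distance [r] from [x0]. There
   [near_x0] applies, and convexity turns its bound into one at [w]. *)
pose s := r / d.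
have s0 : 0 < s by rewrite divr_gt0.
have s01 : 0 <= s <= 1 by rewrite (ltW s0) /= ler_pdivrMr // mul1r ltW.
have [fy] := strongly_convex_fine fw fx0 s01.
have sd : s * d = r by rewrite divfK ?gt_eqF.
have yr : enorm (s *: w + (1 - s) *: x0 - x0) <= r.
  have -> : s *: w + (1 - s) *: x0 - x0 = s *: (w - x0).
    by rewrite scalerBr scalerBl scale1r addrA addrAC addrK.
  by rewrite enormZ ger0_norm -/d ?sd // (andP s01).1.
have := near_x0 _ fy yr; rewrite -/d => h1 h2.
have {h1 h2} h : fine (f x0) - 1 + nu * s * (1 - s) * d ^+ 2
    <= s * fine (f w) + (1 - s) * fine (f x0) by lra.
have ri : r^-1 * d * s = 1 by rewrite -mulrA (mulrC d) sd mulVf ?gt_eqF.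
rewrite -(ler_pM2l s0).
have -> : s * (fine (f x0) - 1 - (r^-1 + nu * r) * d + nu * d ^+ 2)
   = s * fine (f x0) - s - r^-1 * d * s - nu * r * (s * d) + nu * (s * d) * d.
  by ring.
rewrite ri sd.
have : nu * s * (1 - s) * d ^+ 2 = nu * (s * d) * d - nu * (s * d) * (s * d) by ring.
by rewrite sd; move: h s0; lra.
Qed.

(** The midpoint has value at least [m], so strong convexity with parameter one half controls the
    distance of two points by how far their values exceed [m]. This makes minimizing sequences
    Cauchy. *)
Lemma tilted_midpoint zeta m u w : (forall w, edom f w -> m <= tilted zeta w) ->
  edom f u -> edom f w ->
  nu / 2 * enorm (u - w) ^+ 2 <= (tilted zeta u - m) + (tilted zeta w - m).
Proof.
move=> mP fu fw; have half01 : 0 <= (2^-1 : R) <= 1.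
  by rewrite invr_ge0 ler0n invf_le1 // ler1n.
have := strongly_convex_tilted zeta fu fw half01.
have := mP _ (strongly_convex_fine fu fw half01).1.
by set t := tilted _ _; set E := enorm _ ^+ 2; lra.
Qed.

(** Direct method: a minimizing sequence with error [k.+1%:R^-1] is Cauchy by [tilted_midpoint], and
    lower semicontinuity bounds the value at its limit by the infimum. *)
Lemma tilted_min_exists zeta :
  exists2 u, edom f u & forall w, edom f w -> tilted zeta u <= tilted zeta w.
Proof.
have [m0 m0P] := tilted_bounded_below zeta.
pose E := [set tilted zeta w | w in edom f].
have E_inf : has_inf E.
  split; first by have [x0 fx0] := f_proper.2; exists (tilted zeta x0), x0.
  by exists m0 => _ [w fw <-]; exact: m0P.
pose m := inf E.
have mP w : edom f w -> m <= tilted zeta w.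
  by move=> fw; apply: (ge_inf E_inf.2); exists w.
have /choice[x xP] (k : nat) :
    exists w, edom f w /\ tilted zeta w < m + k.+1%:R^-1.
  have [|_ [w fw <-] wm] := @inf_adherent _ E k.+1%:R^-1 _ E_inf.
    by rewrite invr_gt0 ltr0n.
  by exists w.
have inv_small (e : R) : 0 < e -> \forall k \near \oo, (k.+1%:R^-1 < e :> R).
  by move=> e0; exact: (near_infty_natSinv_lt (PosNum e0)).
have x_cvg : cvg (x @ \oo).
  apply/cauchy_cvgP/cauchy_exP => e e0.
  (* Two iterates whose values exceed [m] by less than [c / 2] each are less than [e] apart, by the
     midpoint estimate. *)
  pose c : R := nu / 2 * e ^+ 2.
  have c0 : 0 < c / 2 by rewrite !divr_gt0 ?mulr_gt0 ?divr_gt0 ?exprn_gt0.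
  have [N _ NP] := inv_small _ c0.
  exists (x N), N => // i /= Ni; rewrite -ball_normE /=.
  apply: le_lt_trans (normr_le_enorm _) _.
  rewrite -(ltr_pXn2r (n := 2)) ?nnegrE ?enorm_ge0 ?ltW //.
  rewrite -(ltr_pM2l (divr_gt0 nu_gt0 (ltr0n R 2))).
  apply: le_lt_trans (tilted_midpoint mP (xP N).1 (xP i).1) _.
  have : N.+1%:R^-1 < c / 2 :> R by exact: NP (leqnn N).
  have : i.+1%:R^-1 < c / 2 :> R by exact: NP Ni.
  rewrite -/c; move: (xP N).2 (xP i).2; move: (N.+1%:R^-1) (i.+1%:R^-1) => p q.
  by lra.
pose xl := lim (x @ \oo).
have fxl : (f xl <= (m + dotv zeta xl)%:E)%E.
  rewrite leNgt; apply/negP => lt_fxl.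
  have [a ma afx] : exists2 a, m + dotv zeta xl < a & (a%:E < f xl)%E.
    case: (f xl) lt_fxl => [b||] //; last by exists (m + dotv zeta xl + 1); rewrite ?ltry // ltrDl.
    rewrite lte_fin => mb; exists ((m + dotv zeta xl + b) / 2); rewrite ?lte_fin; lra.
  have [A xlA Af] := f_lsc afx.
  (* Half of the gap below [a] absorbs the error of approximate minimality, the other half the
     variation of the linear tilt. The [+ 1] in [K + 1] keeps the divisor positive when [zeta] is
     zero. *)
  pose eta := (a - (m + dotv zeta xl)) / 2.
  have eta0 : 0 < eta by rewrite divr_gt0 // subr_gt0.
  pose K := \sum_(i < n) `|zeta i 0|.
  have K0 : 0 <= K by exact: sumr_ge0.
  have eK0 : 0 < eta / (K + 1) by rewrite divr_gt0 // ltr_wpDl.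
  have n1 : \forall k \near \oo, A (x k) by exact: x_cvg.
  have n2 : \forall k \near \oo, `|xl - x k| < eta / (K + 1).
    by move/cvgrPdist_lt : (x_cvg : x @ \oo --> xl); apply.
  have [k [[Ak xk] ke]] := filter_ex (filterI (filterI n1 n2) (inv_small _ eta0)).
  have := Af _ Ak; rewrite -(fineK_edom (xP k).1) lte_fin.
  have := (xP k).2; rewrite /tilted.
  have : dotv zeta (x k) - dotv zeta xl <= eta.
    rewrite -dotvBr; apply: le_trans (ler_norm _) _.
    apply: le_trans (normr_dotv_le _ _) _; rewrite -/K distrC.
    apply: le_trans (ler_wpM2l K0 (ltW xk)) _.
    by rewrite mulrCA ler_piMr ?(ltW eta0) // ler_pdivrMr ?ltr_wpDl // mul1r lerDl.
  have : k.+1%:R^-1 < eta by exact: ke.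
  by rewrite /eta; move: (k.+1%:R^-1) => p; lra.
have fx : edom f xl by apply: le_lt_trans fxl _; exact: ltry.
exists xl => // w fw; apply: le_trans (mP _ fw).
by move: fxl; rewrite -(fineK_edom fx) lee_fin /tilted lerBlDr.
Qed.

Lemma argmin_tiltP zeta : edom f (argmin_tilt f zeta) /\
  forall w, edom f w -> tilted zeta (argmin_tilt f zeta) <= tilted zeta w.
Proof.
have [x fx xP] := tilted_min_exists zeta.
have h : exists u, forall w, (f u - (dotv zeta u)%:E <= f w - (dotv zeta w)%:E)%E.
  exists x => w; have [fw|] := boolP (f w < +oo)%E.
    by rewrite -(fineK_edom fx) -(fineK_edom fw) -!EFinB lee_fin; exact: xP.
  by rewrite -leNgt leye_eq => /eqP ->; rewrite leey.
have {h}uP : forall w, (f (argmin_tilt f zeta) - (dotv zeta (argmin_tilt f zeta))%:E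
    <= f w - (dotv zeta w)%:E)%E := @xgetPex _ 0 _ h.
have fu : edom f (argmin_tilt f zeta).
  move: (uP x); rewrite -(fineK_edom fx) /edom /=.
  by case: (f _) => [a||] //; rewrite ?ltry.
split=> // w fw; move: (uP w).
by rewrite -(fineK_edom fu) -(fineK_edom fw) -!EFinB lee_fin.
Qed.

(** Comparing the minimizer with points of the segment towards [w] gives the bound with
    [nu * (1 - lam)] in place of [nu]; small [lam] then gives the full constant. *)
Lemma tilted_quadratic_growth zeta w : edom f w ->
  tilted zeta (argmin_tilt f zeta) + nu * enorm (w - argmin_tilt f zeta) ^+ 2
    <= tilted zeta w.
Proof.
move=> fw; have [fu uP] := argmin_tiltP zeta; set u := argmin_tilt f zeta in fu uP *.
set E := enorm _ ^+ 2; have E0 : 0 <= E by rewrite sqr_ge0.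
have scaled lam : 0 < lam <= 1 -> tilted zeta u + nu * (1 - lam) * E <= tilted zeta w.
  move=> /andP[lam0 lam1]; have lam01 : 0 <= lam <= 1 by rewrite ltW.
  have := strongly_convex_tilted zeta fw fu lam01.
  have := uP _ (strongly_convex_fine fw fu lam01).1.
  by rewrite -/E => h1 h2; rewrite -(ler_pM2l lam0); lra.
rewrite leNgt; apply/negP => h.
have nE : 0 <= nu * E by rewrite mulr_ge0 // ltW.
pose gap := tilted zeta u + nu * E - tilted zeta w.
have gap0 : 0 < gap by rewrite subr_gt0.
have gapE : gap <= nu * E by have := uP _ fw; rewrite /gap; lra.
have nE0 : 0 < nu * E by exact: lt_le_trans gapE.
(* For this [lam] the loss [nu * lam * E] is only half of [gap], which contradicts [scaled]; [gapE]
   ensures that [lam] is at most 1. *)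
pose lam := gap / (2 * (nu * E)).
have d0 : 0 < 2 * (nu * E) by rewrite mulr_gt0.
have lamE : lam * (2 * (nu * E)) = gap by rewrite divfK ?gt_eqF.
have : 0 < lam <= 1 by rewrite divr_gt0 //= ler_pdivrMr // mul1r; lra.
by move=> /scaled; move: lamE gap0; rewrite /gap; lra.
Qed.

End TiltedMinimizer.

(** * Norm bounds for the inverse square root of the regularized matrix *)

Section Preconditioner.
Context {R : realType} {p l : nat} (B : 'M[R]_(p, l)) (gam : R).
Hypothesis gam_gt0 : 0 < gam.
Let A := gam%:M + B *m B^T.
Let M := invsqrtmx A.

Lemma dotv_regularized y :
  dotv y (A *m y) = gam * enorm y ^+ 2 + enorm (B^T *m y) ^+ 2.
Proof.
rewrite mulmxDl dotvDr mul_scalar_mx dotvZr !sqr_enorm -mulmxA.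
by rewrite [dotv (B^T *m y) _]dotv_mull trmxK.
Qed.

Let A_sym : A^T = A.
Proof. by rewrite /A linearD /= tr_scalar_mx trmx_mul trmxK. Qed.

Lemma regularized_unit : A \in unitmx.
Proof.
rewrite -row_free_unit -kermx_eq0; apply/rowV0P => x /sub_kermxP xA.
apply: trmx_inj; rewrite trmx0; apply/eqP; rewrite -enorm_eq0 -sqrf_eq0.
have Ax : A *m x^T = 0 by rewrite -A_sym -trmx_mul xA trmx0.
have := dotv_regularized x^T; rewrite Ax dotvE mulmx0 mxE => /esym h.
have := sqr_ge0 (enorm (B^T *m x^T)); have := sqr_ge0 (enorm x^T) => h1 h2.
rewrite eq_le h1 andbT -(ler_pM2l gam_gt0) mulr0; lra.
Qed.

Lemma invsqrt_regularizedP : M^T = M /\ M *m M = invmx A.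
Proof.
suff /sqrtmxP[[]] : psdmx (invmx A) by [].
split=> [|x]; first by rewrite trmx_inv A_sym.
rewrite -{1}(mulKVmx regularized_unit x) dotvC dotv_regularized.
by rewrite addr_ge0 ?sqr_ge0 // mulr_ge0 ?sqr_ge0 // ltW.
Qed.

(** With [y = invmx A *m x] the claim compares [gam * dotv y (A *m y)] with the squared norm of
    [A *m y]; their difference is [gam * enorm (B^T *m y) ^+ 2 + enorm z ^+ 2]. *)
Lemma invsqrt_regularized_bound x : gam * enorm (M *m x) ^+ 2 <= enorm x ^+ 2.
Proof.
have [MT MM] := invsqrt_regularizedP.
pose y := invmx A *m x; have xE : x = A *m y by rewrite /y mulKVmx ?regularized_unit.
have -> : enorm (M *m x) ^+ 2 = dotv y (A *m y).
  by rewrite sqr_enorm dotv_mull MT mulmxA MM dotvC -/y -xE.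
pose z := B *m (B^T *m y).
have yz : dotv y z = enorm (B^T *m y) ^+ 2.
  by rewrite sqr_enorm [RHS]dotv_mull trmxK.
have Ay : A *m y = gam *: y + z by rewrite mulmxDl mul_scalar_mx -mulmxA.
rewrite xE dotv_regularized (sqr_enorm (A *m y)) Ay.
rewrite !(dotvDl, dotvDr, dotvZl, dotvZr) (dotvC z) yz -!sqr_enorm.
have := mulr_ge0 (ltW gam_gt0) (sqr_ge0 (enorm (B^T *m y))).
by have := sqr_ge0 (enorm z); lra.
Qed.

(** Since [M *m A *m M] is the identity, the squared norm of [x] is the quadratic form of [A] at
    [M *m x], which splits into the claimed term and a nonnegative one. *)
Lemma invsqrt_regularized_contraction x : enorm (B^T *m (M *m x)) <= enorm x.
Proof.
have [MT MM] := invsqrt_regularizedP.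
have MAM : M *m A *m M = 1%:M.
  by apply: mulmx1C; rewrite mulmxA MM mulVmx // regularized_unit.
rewrite -(ler_pXn2r (n := 2)) ?nnegrE ?enorm_ge0 //.
have := dotv_regularized (M *m x); rewrite dotv_mull MT !mulmxA MAM mul1mx -sqr_enorm => ->.
by rewrite -!mulmxA lerDr mulr_ge0 ?sqr_ge0 // ltW.
Qed.

End Preconditioner.

(** * Decrease of the Bregman distance along the iteration *)

Section Descent.
Context {R : realType} {n1 n2 l q : nat}.
Variables (f : 'cV[R]_n2 -> \bar R) (nu : R).
Variables (V : 'I_q -> 'M[R]_(n2, l)) (U : 'I_q -> 'M[R]_(n1, l + 1)).
Variables (B : 'I_q -> 'M[R]_(l + 1, l)).
Variables (v vd : 'I_q -> 'cV[R]_n1) (delta : 'I_q -> R) (tau mu0 mu1 : R).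
Variable usol : 'cV[R]_n2.
Hypotheses (f_proper : proper_fun f) (f_lsc : lower_semicontinuous f).
Hypotheses (nu_gt0 : 0 < nu) (f_sc : strongly_convex nu f).
Hypothesis VtV : forall i, (V i)^T *m V i = 1%:M.
Hypothesis UtU : forall i, (U i)^T *m U i = 1%:M.
Hypothesis usolP : solution_set f V U B v usol.
Hypothesis delta_gt0 : forall i, 0 < delta i.
Hypothesis noiseP : forall i, enorm (vd i - v i) <= delta i.
Hypotheses (tau_gt1 : 1 < tau) (mu0_gt0 : 0 < mu0) (mu1_gt0 : 0 < mu1).
Hypothesis hparam : 0 < 1 - 1 / tau - mu0 / (4 * nu).

Local Notation hvec := (hvec V U B vd).
Local Notation gvec := (gvec V U B vd).
Local Notation active := (active V U B vd delta tau).
Local Notation step_size := (step_size mu0 mu1).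
Local Notation rate := (1 - 1 / tau - mu0 / (4 * nu)).

Lemma enorm_gvec_le gam i u : 0 < gam -> enorm (gvec gam i u) <= enorm (hvec gam i u).
Proof.
move=> gam_gt0; rewrite /Defs.gvec -!mulmxA enorm_isometry //.
exact: invsqrt_regularized_contraction.
Qed.

(** Moving the factors of [gvec] to the other side turns the pairing into [dotv h (h + w)], where
    [w] is the preconditioned noise. The activity test forces [enorm w <= enorm h / tau], and
    Cauchy-Schwarz finishes. *)
Lemma dotv_gvec_ge gam i u : 0 < gam -> active gam i u ->
  (1 - 1 / tau) * enorm (hvec gam i u) ^+ 2 <= dotv (gvec gam i u) (u - usol).
Proof.
move=> gam_gt0; rewrite /Defs.active; set h := hvec gam i u => act.
have tau_gt0 : 0 < tau by exact: lt_trans tau_gt1.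
have [MT _] := invsqrt_regularizedP (B i) gam_gt0.
pose w := precond B gam i *m ((U i)^T *m (vd i - v i)).
have -> : dotv (gvec gam i u) (u - usol) = dotv h (h + w).
  rewrite /Defs.gvec -/h -!mulmxA (dotv_mull (V i)) (dotv_mull (B i)^T).
  rewrite (dotv_mull (precond B gam i)) MT trmxK; congr (dotv h _).
  rewrite /h /Defs.hvec -!mulmxA -mulmxDr -mulmxDr; congr (_ *m _).
  rewrite addrA subrK -(usolP.2 i) /projected_mx -!mulmxA -!mulmxBr.
  by rewrite (mulmxA (U i)^T) UtU mul1mx.
have wB : gam * enorm w ^+ 2 <= delta i ^+ 2.
  apply: le_trans (invsqrt_regularized_bound _ gam_gt0 _) _.
  rewrite ler_pXn2r ?nnegrE ?enorm_ge0 ?(ltW (delta_gt0 i)) //.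
  exact: le_trans (enorm_coisometry_le _ (UtU i)) (noiseP i).
have wh : enorm w <= enorm h / tau.
  rewrite ler_pdivlMr // -(ler_pXn2r (n := 2)) ?nnegrE ?mulr_ge0 ?enorm_ge0 ?(ltW tau_gt0) //.
  rewrite -(ler_pM2l gam_gt0) exprMn mulrA (mulrC _ (tau ^+ 2)).
  by apply: le_trans (ltW act); rewrite ler_wpM2l ?sqr_ge0.
have := dotv_le h (- w); rewrite dotvNr enormN dotvDr -sqr_enorm.
have := ler_wpM2l (enorm_ge0 h) wh.
by rewrite !mulrBl !mul1r mulrA -expr2 [_^-1 * _]mulrC; lra.
Qed.

(** This is also the Fenchel-Young gap of [usol] and [zeta]: the minimal tilted value is minus the
    convex conjugate of [f] at [zeta]. *)
Definition bregman zeta := tilted f zeta usol - tilted f zeta (argmin_tilt f zeta).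

Lemma bregman_ge0 zeta : 0 <= bregman zeta.
Proof.
rewrite subr_ge0.
by have [_] := argmin_tiltP f_proper f_lsc nu_gt0 f_sc zeta; apply; exact: usolP.1.
Qed.

(** Quadratic growth of the old objective is evaluated at the new minimizer [u']; its term in
    [u' - u] absorbs the cross term through Young's inequality. *)
Lemma bregman_step zeta t g :
  bregman (zeta - t *: g) <= bregman zeta
    - t * dotv g (argmin_tilt f zeta - usol) + t ^+ 2 * enorm g ^+ 2 / (4 * nu).
Proof.
set u := argmin_tilt f zeta; set u' := argmin_tilt f (zeta - t *: g).
have [fu' _] := argmin_tiltP f_proper f_lsc nu_gt0 f_sc (zeta - t *: g).
have := tilted_quadratic_growth f_proper f_lsc nu_gt0 f_sc zeta fu'.
have := dotv_young (- t *: g) (u' - u) nu_gt0.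
rewrite enormZ normrN exprMn real_normK ?num_real // /bregman /tilted -/u -/u'.
by rewrite !(dotvBl, dotvBr, dotvZl); lra.
Qed.

(** * A step along a block of active indices, common to inner and outer updates *)

Section BlockStep.
Variables (gam : R) (P : pred 'I_q) (zeta : 'cV[R]_n2).
Hypothesis gam_gt0 : 0 < gam.
Let u := argmin_tilt f zeta.
Hypothesis activeP : forall i, P i -> active gam i u.
Let g := \sum_(i < q | P i) gvec gam i u.
Let Phi := \sum_(i < q | P i) enorm (hvec gam i u) ^+ 2.

Let Phi_ge0 : 0 <= Phi.
Proof. by apply: sumr_ge0 => i _; exact: sqr_ge0. Qed.

Lemma step_size_ge0 : 0 <= step_size Phi g.
Proof.
rewrite /Defs.step_size; case: eqP => _; first exact: ltW.
by rewrite le_min (ltW mu1_gt0) andbT divr_ge0 ?sqr_ge0 // mulr_ge0 // ltW.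
Qed.

Lemma step_size_le : step_size Phi g * enorm g ^+ 2 <= mu0 * Phi.
Proof.
rewrite /Defs.step_size; case: eqVneq => [->|g0].
  have /eqP -> : enorm (0 : 'cV[R]_n2) == 0 by rewrite enorm_eq0.
  by rewrite expr0n mulr0 mulr_ge0 // ltW.
have G0 : 0 < enorm g ^+ 2 by rewrite exprn_gt0 // lt_def enorm_eq0 g0 enorm_ge0.
by rewrite -ler_pdivlMr // ge_min lexx.
Qed.

Lemma bregman_block_step :
  bregman (zeta - step_size Phi g *: g) <= bregman zeta - rate * step_size Phi g * Phi.
Proof.
apply: le_trans (bregman_step _ _ _) _; rewrite -/u.
set t := step_size Phi g.
have gu : (1 - 1 / tau) * Phi <= dotv g (u - usol).
  rewrite dotv_suml mulr_sumr; apply: ler_sum => i Pi.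
  by apply: dotv_gvec_ge => //; exact: activeP.
have t0 : 0 <= t := step_size_ge0.
have nu4 : 0 < 4 * nu by rewrite mulr_gt0.
have : t ^+ 2 * enorm g ^+ 2 / (4 * nu) <= mu0 / (4 * nu) * t * Phi.
  rewrite ler_pdivrMr // expr2 -mulrA.
  apply: le_trans (ler_wpM2l t0 step_size_le) _.
  by rewrite le_eqVlt; apply/orP; left; apply/eqP; field; rewrite gt_eqF.
by have := ler_wpM2l t0 gu; lra.
Qed.

(** Each of the at most [q] summands of [g] has norm at most the square root of [Phi], so the
    quotient in the step size is at least [mu0 / q%:R ^+ 2]. *)
Lemma step_size_lower i : P i ->
  Num.min (mu0 / q%:R ^+ 2) mu1 * enorm (hvec gam i u) ^+ 2 <= step_size Phi g * Phi.
Proof.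
move=> Pi; set h := enorm (hvec gam i u).
have hPhi j : P j -> enorm (hvec gam j u) ^+ 2 <= Phi.
  move=> Pj; rewrite /Phi (bigD1 j) //= lerDl; apply: sumr_ge0 => k _; exact: sqr_ge0.
have q_gt0 : 0 < q%:R :> R by rewrite ltr0n (leq_ltn_trans _ (ltn_ord i)).
have gPhi : enorm g ^+ 2 <= q%:R ^+ 2 * Phi.
  rewrite -(sqr_sqrtr Phi_ge0) -exprMn.
  rewrite ler_pXn2r ?nnegrE ?mulr_ge0 ?enorm_ge0 ?sqrtr_ge0 ?(ltW q_gt0) //.
  apply: le_trans (enorm_sum _ _ _) _.
  apply: (@le_trans _ _ (\sum_(j < q | P j) Num.sqrt Phi)).
    apply: ler_sum => j Pj; apply: le_trans (enorm_gvec_le _ _ gam_gt0) _.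
    by rewrite -[leLHS]ger0_norm ?enorm_ge0 // -sqrtr_sqr ler_wsqrtr ?hPhi.
  rewrite sumr_const -[leLHS]mulr_natl ler_wpM2r ?sqrtr_ge0 // ler_nat.
  by apply: leq_trans (max_card _) _; rewrite card_ord.
have kappa_le : Num.min (mu0 / q%:R ^+ 2) mu1 * Phi <= step_size Phi g * Phi.
  rewrite /Defs.step_size; case: eqVneq => [_|g0].
    by rewrite ler_wpM2r // ge_min lexx orbT.
  have G0 : 0 < enorm g ^+ 2 by rewrite exprn_gt0 // lt_def enorm_eq0 g0 enorm_ge0.
  rewrite ler_wpM2r // le_min !ge_min lexx orbT andbT.
  apply/orP; left; rewrite ler_pdivlMr // mulrAC ler_pdivrMr ?exprn_gt0 //.
  by rewrite -mulrA (ler_pM2l mu0_gt0) mulrC.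
apply: le_trans kappa_le; rewrite ler_wpM2l ?hPhi //.
by rewrite le_min (ltW mu1_gt0) andbT divr_ge0 ?sqr_ge0 // ltW.
Qed.

End BlockStep.

Lemma bregman_inner_step gam i zeta : 0 < gam ->
  bregman (inner_step f V U B vd delta tau mu0 mu1 gam i zeta) <= bregman zeta.
Proof.
move=> gam_gt0; rewrite /inner_step /=; case: ifPn => [act|_]; last first.
  by rewrite scale0r subr0.
(* An active inner update is the block step for the single index [i]. *)
have actP j : pred1 i j -> active gam j (argmin_tilt f zeta) by move=> /eqP ->.
have := bregman_block_step gam_gt0 actP; rewrite !big_pred1_eq => /le_trans; apply.
rewrite gerBl mulr_ge0 ?sqr_ge0 // mulr_ge0 ?(ltW hparam) //.
by have := step_size_ge0 gam (pred1 i) zeta; rewrite !big_pred1_eq.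
Qed.

Lemma bregman_outer_step gam i zeta : 0 < gam ->
  active gam i (argmin_tilt f zeta) ->
  bregman (outer_step f V U B vd delta tau mu0 mu1 gam zeta) <= bregman zeta
    - rate * Num.min (mu0 / q%:R ^+ 2) mu1 * (tau ^+ 2 * delta i ^+ 2 / gam).
Proof.
move=> gam_gt0 act.
pose P := [pred j | active gam j (argmin_tilt f zeta)].
have := @bregman_block_step gam P zeta gam_gt0 (fun _ => id).
move=> /le_trans; apply.
set d := tau ^+ 2 * delta i ^+ 2 / gam; rewrite lerD2l lerN2 -!mulrA ler_pM2l //.
apply: le_trans (@step_size_lower gam P zeta gam_gt0 i act).
rewrite ler_wpM2l //.
  by rewrite le_min (ltW mu1_gt0) andbT divr_ge0 ?sqr_ge0 // ltW.
by rewrite ler_pdivrMr // [leRHS]mulrC; exact: ltW.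
Qed.

End Descent.

(** * Termination by summing the decrease over the outer steps *)

Theorem lemma4p2 (R : realType) (n1 n2 l q : nat)
    (f : 'cV[R]_n2 -> \bar R) (nu : R)
    (T : 'I_q -> 'M[R]_(n1, n2)) (V : 'I_q -> 'M[R]_(n2, l))
    (U : 'I_q -> 'M[R]_(n1, l + 1)) (B : 'I_q -> 'M[R]_(l + 1, l))
    (v vd : 'I_q -> 'cV[R]_n1) (delta : 'I_q -> R)
    (gamma : nat -> R) (tau mu0 mu1 : R)
    (zeta0 : 'cV[R]_n2) (mm : nat -> nat)
    (hl0 : (1 <= l)%N) (hl : (l < minn n1 n2)%N)
    (f_proper : proper_fun f) (f_lsc : lower_semicontinuous f)
    (nu_gt0 : 0 < nu) (f_sc : strongly_convex nu f)
    (hGK : forall i, golub_kahan (T i) (V i) (U i) (B i))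
    (hS : solution_set f V U B v !=set0)
    (delta_gt0 : forall i, 0 < delta i)
    (hnoise : forall i, enorm (vd i - v i) <= delta i)
    (gamma_gt0 : forall j, 0 < gamma j)
    (gamma_dec : nonincreasing_seq gamma)
    (gamma_sum : (\sum_(0 <= j <oo) ((gamma j)^-1)%:E = +oo)%E)
    (mm_gt0 : forall k, (0 < mm k)%N)
    (mu1_gt0 : 0 < mu1) (tau_gt1 : 1 < tau) (mu0_gt0 : 0 < mu0)
    (hparam : 0 < 1 - 1 / tau - mu0 / (4 * nu)) :
  forall idx : nat -> nat -> 'I_q,
    exists kd : nat,
      stopping_index f V U B vd delta gamma tau mu0 mu1 zeta0 mm idx kd.
Proof.
move=> idx; set stop := stop_test f V U B vd delta gamma tau mu0 mu1 zeta0 mm idx.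
(* Any positive index passing the test suffices, as the least such index is the stopping index. *)
suff ex_stop : exists k, (0 < k)%N && `[< stop k >].
  have [kd /andP[kd_gt0 /asboolP kdP] kd_min] := find_ex_minn ex_stop.
  exists kd; split=> // k /andP[k_gt0 k_lt] /asboolP kP.
  by have := kd_min k; rewrite k_gt0 kP leqNgt k_lt => /(_ isT).
apply: contrapT => nstop.
have [usol usolP] := hS.
have VtV i : (V i)^T *m V i = 1%:M by case: (hGK i).
have UtU i : (U i)^T *m U i = 1%:M by case: (hGK i).
(* A positive lower bound for all noise levels; [idx 0%N 0%N] shows that the finite index set is
   nonempty. *)
have [dm dm_gt0 dmP] : exists2 dm, 0 < dm & forall i, dm <= delta i.
  have [i _ iP] := @Order.TotalTheory.arg_minP _ _ _ (idx 0%N 0%N) xpredT delta isT.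
  by exists (delta i) => // j; exact: iP.
pose D := bregman f usol.
pose zs := zeta_start f V U B vd delta gamma tau mu0 mu1 zeta0 mm idx.
pose loop := inner_loop f V U B vd delta gamma tau mu0 mu1 mm idx.
(* The guaranteed decrease of a failing outer step, made uniform by taking the least noise level and
   the largest parameter [gamma 0%N]. *)
pose eps := (1 - 1 / tau - mu0 / (4 * nu)) * Num.min (mu0 / q%:R ^+ 2) mu1
  * (tau ^+ 2 * dm ^+ 2 / gamma 0%N).
have q_gt0 : 0 < q%:R :> R by rewrite ltr0n (leq_ltn_trans _ (ltn_ord (idx 0%N 0%N))).
have rate_gt0 : 0 < (1 - 1 / tau - mu0 / (4 * nu)) * Num.min (mu0 / q%:R ^+ 2) mu1.
  by rewrite mulr_gt0 // lt_min mu1_gt0 andbT divr_gt0 ?exprn_gt0.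
have tau_gt0 : 0 < tau by exact: lt_trans tau_gt1.
have eps_gt0 : 0 < eps by rewrite mulr_gt0 // divr_gt0 // mulr_gt0 ?exprn_gt0.
have loop_le k z m : D (loop k z m) <= D z.
  elim: m => //= m; apply: le_trans.
  exact: (bregman_inner_step f_proper f_lsc nu_gt0 f_sc UtU usolP delta_gt0).
(* Under [nstop] every index [k.+1] fails the test, so some equation is active at each outer
   step. *)
have start_le k : D (zs k.+1) <= D (zs k) - eps.
  pose z := loop k (zs k) (mm k).
  pose gam := gamma (outer_count mm k.+1).
  have [i iP] : exists i, active V U B vd delta tau gam i (argmin_tilt f z).
    apply: contrapT => none; apply: nstop; exists k.+1; rewrite /=.
    apply/asboolP => i; rewrite leNgt; apply/negP => iP.
    by apply: none; exists i.
  have gam_gt0 : 0 < gam by exact: gamma_gt0.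
  apply: le_trans (bregman_outer_step f_proper f_lsc nu_gt0 f_sc VtV UtU usolP
    delta_gt0 hnoise tau_gt1 mu0_gt0 mu1_gt0 hparam gam_gt0 iP) _.
  apply: lerB; first exact: loop_le.
  rewrite ler_wpM2l ?(ltW rate_gt0) //; apply: ler_pM.
  - by rewrite mulr_ge0 ?sqr_ge0.
  - by rewrite invr_ge0 ltW.
  - by rewrite ler_wpM2l ?sqr_ge0 // ler_pXn2r ?nnegrE ?(ltW dm_gt0) ?(ltW (delta_gt0 i)).
  - by rewrite lef_pV2 ?posrE //; exact: gamma_dec.
have total k : D (zs k) <= D zeta0 - k%:R * eps.
  elim: k => [|k ih]; first by rewrite mul0r subr0.
  by apply: le_trans (start_le k) _; rewrite -natr1 mulrDl mul1r; lra.
(* After more than [D zeta0 / eps] outer steps the bound in [total] is negative, contradicting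
   [bregman_ge0]. *)
pose K := Num.truncn (D zeta0 / eps).
have := total K.+1; apply/negP; rewrite -ltNge.
apply: lt_le_trans (bregman_ge0 f_proper f_lsc nu_gt0 f_sc usolP _).
by rewrite subr_lt0 -ltr_pdivrMr // truncnS_gt.
Qed.
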